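(* Let $(\mathrm{X},\Sigma,\mu)$ be a measure space and $p\in[1,\infty)$. Let $(f_n)$ be a sequence in $\Lambda_p(\mathrm{X})$ and let $f$ be a measurable function. Assume that $(f_n)$ converges to $f$ in measure and that there exists $g\in\Lambda_p(\mathrm{X})$ such that $\sup_n|f_n|\le g$ almost everywhere. Then $f\in\Lambda_p(\mathrm{X})$ and $\|f_n-f\|_{\alpha_p}\to0$ as $n\to\infty$.
   Context: Measurable functions are real-valued and identified $\mu$-a.e.; $L_0(\mathrm{X})$ denotes the space of such functions and $L_p(\mathrm{X})$ the usual Lebesgue space with norm $\|\cdot\|_p$. $\Lambda_p(\mathrm{X})$ is the set of $f\in L_0(\mathrm{X})$ such that for every $\delta>0$ there exists $E_\delta\in\Sigma$ with $\mu(E_\delta)<\delta$ and $f\chi_{E_\delta^c}\in L_p(\mathrm{X})$. For a measurable function $f$, $\|f\|_{\alpha_p}=\|\min(|f|,1)\|_p$. $(f_n)$ converges in measure to $f$ if $\mu(|f_n-f|>\delta)\to0$ as $n\to\infty$ for each $\delta>0$. *)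

(* Defs.v *)
From mathcomp Require Import all_boot all_order all_algebra.
From mathcomp Require Import all_classical all_reals all_analysis.

Set Implicit Arguments.
Unset Strict Implicit.
Unset Printing Implicit Defensive.

Import Order.TTheory GRing.Theory Num.Theory.
Import numFieldNormedType.Exports.

Local Open Scope classical_set_scope.
Local Open Scope ring_scope.

(** Elements of [L_0] are given by representatives in [{mfun T >-> R}]; all the
    notions below depend only on the mu-a.e. class of the functions. *)

Definition Lambda {d : measure_display} {T : measurableType d} {R : realType}
    (mu : {measure set T -> \bar R}) (p : R) : set {mfun T >-> R} :=
  [set f | forall delta : R, 0 < delta ->
     exists E : set T, [/\ measurable E,
       (mu E < delta%:E)%E &
       (f : T -> R) \* \1_(~` E) \in Lfun mu p%:E]].

(** Extended-real valued: on a space of infinite measure, [alpha_norm mu p f]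
    may be [+oo]. *)
Definition alpha_norm {d : measure_display} {T : measurableType d}
    {R : realType} (mu : {measure set T -> \bar R}) (p : R) (f : T -> R) :
    \bar R :=
  Lnorm mu p%:E (fun x => (Num.min `|f x| 1)%:E).

Definition cvg_in_measure {d : measure_display} {T : measurableType d}
    {R : realType} (mu : {measure set T -> \bar R})
    (f_ : nat -> {mfun T >-> R}) (f : {mfun T >-> R}) : Prop :=
  forall delta : R, 0 < delta ->
    mu [set x | delta < `|f_ n x - f x|] @[n --> \oo] --> 0%E.

(* Main.v *)
(** Passing to the limit in measure in [|f_n| <= g] gives [|f| <= g] a.e., so
    that [f] inherits membership in [Lambda_p], and [|f_n - f| <= 2g] a.e. For
    [c > 0] one then has, pointwise a.e.,
      [min(|f_n - f|, 1)^p <= 2^p min(g, c)^p + 1_{|f_n - f| > c}].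
    The integral of [min(g, c)^p] tends to [0] with [c] by dominated
    convergence, because [min(g, 1)] is in [L_p], and for fixed [c] the measure
    of [{|f_n - f| > c}] tends to [0] with [n]. *)

Require Import Defs.
From mathcomp Require Import all_boot all_order all_algebra.
From mathcomp Require Import all_classical all_reals all_analysis.
From mathcomp Require Import measurable_realfun.

Set Implicit Arguments.
Unset Strict Implicit.
Unset Printing Implicit Defensive.

Import Order.TTheory GRing.Theory Num.Theory.
Import numFieldNormedType.Exports.

Local Open Scope classical_set_scope.
Local Open Scope ring_scope.

(** A real upper bound makes a nonnegative extended real finite, so the usual epsilon criterion
    applies even though finitely many terms may be [+oo]. *)
Lemma ge0_cvge0P (R : realType) (u : nat -> \bar R) :
  (forall n, 0 <= u n)%E ->
  u n @[n --> \oo] --> 0%E <->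
  (forall e : R, 0 < e -> \forall n \near \oo, (u n <= e%:E)%E).
Proof.
move=> u0; split=> [/fine_cvgP[ufin ucvg] e e0|h].
  move/cvgrPdist_le : ucvg => /(_ e e0); apply: filterS2 ufin => n ufin.
  by rewrite sub0r normrN ger0_norm ?fine_ge0//= -[X in (X <= _)%E]fineK.
apply/fine_cvgP; split.
  have := h 1 ltr01; apply: filterS => n un1.
  by rewrite ge0_fin_numE// (le_lt_trans un1) ?ltry.
apply/cvgrPdist_le => e e0; have := h e e0; apply: filterS => n une.
have ufin : u n \is a fin_num by rewrite ge0_fin_numE// (le_lt_trans une) ?ltry.
by rewrite sub0r normrN ger0_norm ?fine_ge0//= -lee_fin fineK.
Qed.

(** Used with [r = p^-1] to pass from the integral of a [p]-th power to the norm. *)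
Lemma cvge0_poweR (R : realType) (u : nat -> \bar R) (r : R) : 0 < r ->
  (forall n, 0 <= u n)%E -> u n @[n --> \oo] --> 0%E ->
  (u n `^ r)%E @[n --> \oo] --> 0%E.
Proof.
move=> r0 u0 /(ge0_cvge0P u0) ucvg; apply/ge0_cvge0P => [n|e e0].
  exact: poweR_ge0.
have er0 : 0 < e `^ r^-1 by exact: powR_gt0.
have := ucvg _ er0; apply: filterS => n une.
have -> : (e%:E = (e `^ r^-1)%:E `^ r)%E.
  by rewrite poweR_EFin -powRrM mulVf ?gt_eqF// powRr1// ltW.
by apply: gt0_ler_poweR => //;
  rewrite ?(ltW r0)// in_itv/= leey andbT ?u0 ?lee_fin ?(ltW er0).
Qed.

Section Lambda_spaces.
Context {d : measure_display} {T : measurableType d} {R : realType}.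
Variables (mu : {measure set T -> \bar R}) (p : R).
Hypothesis p1 : 1 <= p.
Implicit Types f g : {mfun T >-> R}.

Let p_gt0 : 0 < p. Proof. exact: lt_le_trans p1. Qed.

Let powR_le (a b : R) : 0 <= a -> a <= b -> a `^ p <= b `^ p.
Proof.
by move=> a0 ab; rewrite ge0_ler_powR ?nnegrE ?(ltW p_gt0)// (le_trans a0).
Qed.

(** The exceptional set chosen for [g] serves for [f] too: off it, the integral of [|f|^p] is at
    most that of [|g|^p]. *)
Lemma Lambda_le f g : Lambda mu p g ->
  {ae mu, forall x, `|f x| <= `|g x|} -> Lambda mu p f.
Proof.
move=> Lg fg delta /Lg[E [mE muE LgE]]; exists E; split=> //.
have mfE : measurable_fun setT ((f : T -> R) \* \1_(~` E)).
  by apply: measurable_funM => //; exact/measurable_indic/measurableC.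
move/(Lfun_integrable p1)/integrableP : LgE => [mgE gEoo].
rewrite inE; apply/andP; split; first by rewrite inE.
rewrite inE /= /finite_norm.
(* It suffices that the [p]-th power of the norm, which is an integral, be finite. *)
apply: (@lty_poweRy _ _ p); first by rewrite gt_eqF.
rewrite powR_Lnorm ?gt_eqF//.
apply: le_lt_trans gEoo; apply: ae_ge0_le_integral => //.
- by move=> x _; exact: poweR_ge0.
- apply: (measurableT_comp (measurable_poweR _)) => //.
  by apply: measurableT_comp => //; exact: measurableT_comp.
- exact: measurableT_comp.
apply: filterS fg => x fgx _ /=.
rewrite lee_fin [leRHS]ger0_norm ?powR_ge0// powR_le//.
by rewrite !normrM ler_wpM2r.
Qed.

(** Let [E] be an exceptional set for [delta = 1]. The integrand is at most [1] on [E], which has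
    finite measure, and at most [|g|^p] off [E], where this is integrable. *)
Lemma Lambda_alpha_integrable g : Lambda mu p g ->
  mu.-integrable setT (fun x => ((Num.min `|g x| 1) `^ p)%:E).
Proof.
move=> /(_ 1 ltr01)[E [mE muE /(Lfun_integrable p1) igE]].
have iE : mu.-integrable setT (fun x => (\1_E x : R)%:E).
  apply/integrableP; split.
    by apply: measurableT_comp => //; exact: measurable_indic.
  under eq_integral do rewrite gee0_abs ?lee_fin//.
  by rewrite integral_indic// setIT (lt_trans muE) ?ltry.
apply: le_integrable (integrableD measurableT iE igE) => //.
  apply: measurableT_comp => //; apply: (measurableT_comp (measurable_powR _)).
  by apply: measurable_minr => //; exact: measurableT_comp.
move=> x _ /=; rewrite lee_fin [leLHS]ger0_norm ?powR_ge0//.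
rewrite [leRHS]ger0_norm ?addr_ge0 ?powR_ge0//.
rewrite !indicE in_setC; have [xE|xE] := boolP (x \in E) => /=.
  rewrite mulr0 normr0 powR0 ?gt_eqF// addr0.
  rewrite (_ : 1%:R = 1 `^ p); last by rewrite powR1.
  by rewrite powR_le ?le_min ?normr_ge0//= ge_min lexx orbT.
rewrite mulr1 add0r.
by rewrite powR_le ?le_min ?normr_ge0 ?ler01//= ge_min lexx.
Qed.

(** Dominated convergence; the term [k = 0] dominates all the others. *)
Lemma Lambda_truncation_cvg0 g : Lambda mu p g ->
  (\int[mu]_x ((Num.min `|g x| k.+1%:R^-1) `^ p)%:E)%E @[k --> \oo] --> 0%E.
Proof.
move=> /Lambda_alpha_integrable ig.
have := @dominated_convergence _ T R mu setT measurableT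
  (fun k x => ((Num.min `|g x| k.+1%:R^-1) `^ p)%:E) (cst 0%E) _.
move=> /(_ (fun x => ((Num.min `|g x| 1) `^ p)%:E)) [] //.
- move=> k; apply: measurableT_comp => //.
  apply: (measurableT_comp (measurable_powR _)).
  by apply: measurable_minr => //; exact: measurableT_comp.
- apply: nearW => x _.
  apply: (@squeeze_cvge _ _ _ _ (cst 0%E) _ (fun k => (k.+1%:R^-1)%:E)).
  + apply: nearW => k; rewrite !lee_fin powR_ge0/=.
    have k0 : 0 < k.+1%:R^-1 :> R by rewrite invr_gt0.
    (* Since [a^p <= a] for [0 < a <= 1] and [p >= 1], the integrand is at most [k.+1%:R^-1]. *)
    apply: le_trans (ge1r_powR _ p1).
      by rewrite powR_le ?le_min ?normr_ge0 ?(ltW k0)//= ge_min lexx orbT.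
    by rewrite k0/= invf_le1// ler1n.
  + exact: cvg_cst.
  + by apply: cvg_EFin; [exact: nearW|exact: cvg_harmonic].
- apply: nearW => x k _; rewrite lee_fin ger0_norm ?powR_ge0//.
  rewrite powR_le ?le_min ?normr_ge0 ?invr_ge0//=.
  by rewrite !ge_min lexx/= invf_le1// ler1n orbT.
- by rewrite integral0.
Qed.

Lemma measurable_set_ltr (u v : T -> R) :
  measurable_fun setT u -> measurable_fun setT v ->
  measurable [set x | u x < v x].
Proof.
move=> mu_ mv; rewrite -[X in measurable X]setTI.
rewrite (_ : mkset _ = (fun x => u x < v x) @^-1` [set true]).
  by apply: (measurable_fun_ltr mu_ mv).
by apply/seteqP; split => x /=.
Qed.

(** For each [k], the set where [|f|] exceeds [|g| + 1/(k+1)] lies, up to a null set, in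
    [{|f_n - f| > 1/(k+1)}] for every [n], hence is null. Countably many [k] suffice, and no a.e.
    convergent subsequence is extracted. *)
Lemma cvg_in_measure_ae_le (f_ : nat -> {mfun T >-> R}) f g :
  cvg_in_measure mu f_ f ->
  (forall n, {ae mu, forall x, `|f_ n x| <= `|g x|}) ->
  {ae mu, forall x, `|f x| <= `|g x|}.
Proof.
move=> f_f f_g.
have : {ae mu, forall x, forall k, `|f x| <= `|g x| + k.+1%:R^-1}.
  apply: ae_foralln => k.
  pose B := [set x | `|g x| + k.+1%:R^-1 < `|f x|].
  have mB : measurable B.
    apply: measurable_set_ltr; last exact: measurableT_comp.
    by apply: measurable_funD => //; exact: measurableT_comp.
  have k0 : 0 < k.+1%:R^-1 :> R by rewrite invr_gt0.
  suff B0 : mu B = 0%E.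
    by exists B; split=> // x /negP; rewrite -ltNge.
  apply/eqP; rewrite -measure_le0; apply/lee_addgt0Pr => e e0.
  rewrite add0e.
  (* A single index [n] with [mu {|f_n - f| > 1/(k+1)} <= e] is enough. *)
  have /(ge0_cvge0P _)/(_ e e0)[//|n _ /(_ n (leqnn n)) /= le_e] := f_f _ k0.
  apply: le_trans le_e.
  have [N [mN N0 subN]] := f_g n.
  set A := [set x | _].
  have mA : measurable A.
    apply: measurable_set_ltr => //; apply: measurableT_comp => //.
    exact: measurable_funB.
  have BAN : B `<=` A `|` N.
    move=> x Bx; have [fgx|fgx] := leP `|f_ n x| `|g x|; last first.
      by right; apply: subN => /=; apply/negP; rewrite -ltNge.
    (* Here [|f_n - f| >= |f| - |f_n| >= |f| - |g| > 1/(k+1)] at [x]. *)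
    left; rewrite /A/=; move: Bx; rewrite /B/= -ltrBrDl => /lt_le_trans; apply.
    by rewrite distrC (le_trans _ (lerB_dist _ _))// lerB.
  apply: (@le_trans _ _ (mu (A `|` N))).
    by rewrite le_measure ?inE//; exact: measurableU.
  by rewrite -[leRHS]adde0 -N0; exact: measureU2.
apply: filterS => x fgx; rewrite leNgt; apply/negP => /ltr_add_invr[k].
by apply/negP; rewrite -leNgt.
Qed.

Lemma alpha_norm_cvg0 (f_ : nat -> {mfun T >-> R}) f g : Lambda mu p g ->
  cvg_in_measure mu f_ f ->
  (forall n, {ae mu, forall x, `|f_ n x - f x| <= 2 * `|g x|}) ->
  alpha_norm mu p (fun x => f_ n x - f x) @[n --> \oo] --> 0%E.
Proof.
move=> Lg f_f f_g; pose m k x := (Num.min `|g x| k.+1%:R^-1) `^ p.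
have m0 k x : 0 <= m k x by exact: powR_ge0.
have mm k : measurable_fun setT (m k).
  apply: (measurableT_comp (measurable_powR _)).
  by apply: measurable_minr => //; exact: measurableT_comp.
(* The norm is the [1/p]-th power of an integral, so it is enough that the integral tends to [0]. *)
rewrite /alpha_norm unlock; apply: cvge0_poweR; first by rewrite invr_gt0.
  by move=> n; apply: integral_ge0 => x _; exact: poweR_ge0.
apply/ge0_cvge0P => [n|e e0].
  by apply: integral_ge0 => x _; exact: poweR_ge0.
have P0 : 0 < 2 `^ p :> R by rewrite powR_gt0.
have c0 : 0 < e / 2 / 2 `^ p by rewrite !divr_gt0.
have /(ge0_cvge0P _)/(_ _ c0)[k|k _ /(_ k (leqnn k))/= mk] :=
  Lambda_truncation_cvg0 Lg.
  by apply: integral_ge0 => x _; rewrite lee_fin m0.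
have k0 : 0 < k.+1%:R^-1 :> R by rewrite invr_gt0.
have e20 : 0 < e / 2 by rewrite divr_gt0.
have /(ge0_cvge0P _)/(_ _ e20) := f_f _ k0.
move=> /(_ (fun=> measure_ge0 _ _)); apply: filterS => n.
set A := [set x | _] => muA.
have mA : measurable A.
  apply: measurable_set_ltr => //; apply: measurableT_comp => //.
  exact: measurable_funB.
pose v x := (2 `^ p * m k x)%:E; pose w x := (\1_A x : R)%:E.
have mv : measurable_fun setT v.
  by apply: measurableT_comp => //; exact: measurable_funM.
have mw : measurable_fun setT w.
  by apply: measurableT_comp => //; exact: measurable_indic.
have v0 x : (0 <= v x)%E by rewrite lee_fin mulr_ge0// ltW.
have w0 x : (0 <= w x)%E by rewrite lee_fin.
apply: (@le_trans _ _ (\int[mu]_x (v x + w x))%E); last first.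
  rewrite ge0_integralD// integral_indic// setIT.
  under eq_integral do rewrite /v EFinM.
  rewrite ge0_integralZl_EFin ?(ltW P0)//; last 2 first.
  - by move=> x _; rewrite lee_fin.
  - exact: measurableT_comp.
  rewrite [e]splitr EFinD leeD//.
  rewrite -[leRHS](_ : (2 `^ p)%:E * (e / 2 / 2 `^ p)%:E = _)%E; last first.
    by rewrite -EFinM mulrCA divff ?mulr1// gt_eqF.
  by rewrite lee_wpmul2l// lee_fin ltW.
(* It remains to bound the integrand a.e. by [v + w]: [w] takes care of [A] and [v] of its
   complement. *)
apply: ae_ge0_le_integral => //.
- apply: measurableT_comp => //; apply: (measurableT_comp (measurable_powR _)).
  apply: measurableT_comp => //; apply: measurable_minr => //.
  by apply: measurableT_comp => //; exact: measurable_funB.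
- by move=> x _; rewrite adde_ge0.
- exact: emeasurable_funD.
apply: filterS (f_g n) => x fgx _ /=.
rewrite lee_fin ger0_norm ?le_min ?normr_ge0 ?ler01// indicE.
have [xA|xA] := boolP (x \in A).
  rewrite -[leLHS]add0r lerD ?mulr_ge0 ?(ltW P0)//.
  rewrite [leRHS](_ : _ = 1 `^ p); last by rewrite powR1.
  by rewrite powR_le ?le_min ?normr_ge0//= ge_min lexx orbT.
(* Off [A], with [c = 1/(k+1)], [v] is [min(2|g|, 2c)^p], while [|f_n - f|] is at most [2|g|] and at
   most [c <= 2c]. *)
rewrite addr0 /m -powRM// ?le_min ?normr_ge0 ?(ltW k0)//.
rewrite powR_le ?le_min ?normr_ge0//= minr_pMr// le_min.
move: xA; rewrite notin_setE/= => /negP; rewrite -leNgt => fk.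
rewrite !ge_min fgx/=; apply/orP; left; apply: le_trans fk _.
by rewrite ler_peMl ?(ltW k0)// ler1n.
Qed.

End Lambda_spaces.

Theorem proposition4p3 (d : measure_display) (T : measurableType d)
    (R : realType) (mu : {measure set T -> \bar R}) (p : R) (p1 : 1 <= p)
    (f_ : nat -> {mfun T >-> R}) (f : {mfun T >-> R})
    (Lambda_f_ : forall n, Lambda mu p (f_ n))
    (f_f : cvg_in_measure mu f_ f)
    (dominated : exists2 g : {mfun T >-> R}, Lambda mu p g &
       {ae mu, forall x,
          (ereal_sup (range (fun n => `|f_ n x|%:E)) <= (g x)%:E)%E}) :
  Lambda mu p f /\
  alpha_norm mu p (fun x => f_ n x - f x) @[n --> \oo] --> 0%E.
Proof.
have [g Lg supg] := dominated.
(* Passing from [g] to [|g|] frees the lemmas from any sign condition on [g]. *)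
have f_g n : {ae mu, forall x, `|f_ n x| <= `|g x|}.
  apply: filterS supg => x /(le_trans (ereal_sup_ubound _)) fgx.
  by rewrite (le_trans _ (ler_norm _))// -lee_fin fgx//; exists n.
have fg := cvg_in_measure_ae_le f_f f_g.
split; first exact: (Lambda_le p1 Lg fg).
apply: (alpha_norm_cvg0 p1 Lg f_f) => n.
apply: filterS2 (f_g n) fg => x fngx fgx.
by rewrite (le_trans (ler_normB _ _))// mulr_natl mulr2n lerD.
Qed.
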